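(* Let $\mathcal{C}$ be a Cayley algebra over an arbitrary field $\mathbb{F}$ with norm $\mathrm{n}$. Then the space of local derivations of $\mathcal{C}$ is the Lie algebra $\{d\in\mathfrak{so}(\mathcal{C},\mathrm{n})\mid d(1)=0\}$.
   Context: A Cayley algebra over a field $\mathbb{F}$ is a unital (not necessarily associative) $\mathbb{F}$-algebra $\mathcal{C}$ of dimension $8$ endowed with a quadratic form $\mathrm{n}:\mathcal{C}\to\mathbb{F}$ (the norm) that is multiplicative, $\mathrm{n}(xy)=\mathrm{n}(x)\mathrm{n}(y)$ for all $x,y\in\mathcal{C}$, and nonsingular, i.e. its polar form $\mathrm{n}(x,y):=\mathrm{n}(x+y)-\mathrm{n}(x)-\mathrm{n}(y)$ is a nondegenerate bilinear form. A derivation of $\mathcal{C}$ is a linear map $d:\mathcal{C}\to\mathcal{C}$ with $d(xy)=d(x)y+xd(y)$ for all $x,y$. A local derivation of $\mathcal{C}$ is a linear map $\Delta:\mathcal{C}\to\mathcal{C}$ such that for every $x\in\mathcal{C}$ there is a derivation $d_x$ of $\mathcal{C}$ (depending on $x$) with $\Delta(x)=d_x(x)$. $\mathfrak{so}(\mathcal{C},\mathrm{n})=\{d\in\mathrm{End}_{\mathbb{F}}(\mathcal{C})\mid \mathrm{n}(x,d(x))=0\ \text{for all } x\in\mathcal{C}\}$, where $\mathrm{n}(\cdot,\cdot)$ is the polar form, with Lie bracket the commutator. *)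

(* Defs.v *)
From mathcomp Require Import all_boot all_algebra.

Set Implicit Arguments.
Unset Strict Implicit.
Unset Printing Implicit Defensive.

Import GRing.Theory.
Local Open Scope ring_scope.

Definition polar (F : fieldType) (V : vectType F) (n : V -> F) (x y : V) : F :=
  n (x + y) - n x - n y.

Record quadratic_form (F : fieldType) (V : vectType F) (n : V -> F) : Prop :=
  QuadraticForm {
    quadratic_formZ : forall (a : F) (x : V), n (a *: x) = a ^+ 2 * n x;
    polar_linearl : forall y : V, scalar (polar n ^~ y);
    polar_linearr : forall x : V, scalar (polar n x)
  }.

(* polar n is symmetric, so left and right radicals coincide. *)
Definition nonsingular (F : fieldType) (V : vectType F) (n : V -> F) : Prop :=
  forall x : V, (forall y : V, polar n x y = 0) -> x = 0.

(* The product is not assumed associative, so C is only a vectType and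
   the multiplication and its unit are explicit. *)
Record cayley_algebra (F : fieldType) (C : vectType F)
    (mul : {bilinear C -> C -> C}) (one : C) (n : C -> F) : Prop :=
  CayleyAlgebra {
    cayley_dim : \dim {:C} = 8%N;
    cayley_mul1l : left_id one mul;
    cayley_mul1r : right_id one mul;
    cayley_norm_quadratic : quadratic_form n;
    cayley_normM : forall x y : C, n (mul x y) = n x * n y;
    cayley_norm_nonsingular : nonsingular n
  }.

Definition derivation (F : fieldType) (C : vectType F)
    (mul : {bilinear C -> C -> C}) (d : 'End(C)) : Prop :=
  forall x y : C, d (mul x y) = mul (d x) y + mul x (d y).

Definition local_derivation (F : fieldType) (C : vectType F)
    (mul : {bilinear C -> C -> C}) (D : 'End(C)) : Prop :=
  forall x : C, exists d : 'End(C), derivation mul d /\ D x = d x.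

Definition so (F : fieldType) (V : vectType F) (n : V -> F) (d : 'End(V)) :
  Prop := forall x : V, polar n x (d x) = 0.

Definition lie_bracket (F : fieldType) (V : vectType F) (f g : 'End(V)) :
  'End(V) := (f \o g)%VF - (g \o f)%VF.

Definition lie_subalgebra (F : fieldType) (V : vectType F)
    (L : 'End(V) -> Prop) : Prop :=
  [/\ L 0,
      forall (a : F) (f g : 'End(V)), L f -> L g -> L (a *: f + g)
    & forall f g : 'End(V), L f -> L g -> L (lie_bracket f g)].

(* Main.v *)
From HB Require Import structures.
Require Import Defs.
From mathcomp Require Import all_boot all_algebra ring zify.

Set Implicit Arguments.
Unset Strict Implicit.
Unset Printing Implicit Defensive.

Import GRing.Theory.
Local Open Scope ring_scope.

(** Write b for the polar form of the norm n and c' for the conjugate of c.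

    A derivation d kills 1, and applying it to the quadratic equation
    x x = b(1,x) x - n(x) 1 gives b(1,d x) x = b(x,d x) 1.  Hence
    b(x,d x) = 0 when x is not a scalar, and this is trivial when x is a scalar.
    So every local derivation is skew and kills 1.  Skew maps killing 1 form a Lie
    algebra by direct computation.

    For the converse it is enough that, for every nonscalar x, the vectors d x
    with d a derivation fill the orthogonal of {1, x} (lemma
    [derivation_transitive]).  Derivations come from local triality, in the form
    valid in every characteristic (lemma [triality]):
      b(xy,c) a - b(xy,a) c + b(a,c) xy = (a (c' x)) y + x ((y c') a).
    If finitely many pairs satisfy sum a_i c_i' = 0 = sum c_i' a_i, summing these
    identities shows that z |-> sum (b(z,c_i) a_i - b(z,a_i) c_i) is a derivation.

    The values at x of these derivations form the image of the kernel of a linear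
    map, hence are determined by the functionals b(z,_) that vanish on them.  By
    duality such a z satisfies, for some p and q and for all c,
      p c + c q = b(x,c) z - b(z,c) x.
    Rewriting c q + q c as a combination of c, q and 1 turns this into the
    statement that r = p + q' satisfies r' = -r and that r C lies in the span of
    1, x, z, q, of dimension at most 4.  Left multiplication by r has rank 8 if
    n(r) is not 0, which is too much; if n(r) = 0 and r is not 0, it has rank at
    least 4, so r C contains 1, contradicting n(r) = 0.  Therefore r = 0, and the
    resulting equation b(x,c) z - b(z,c) x = b(1,c) q - b(q,c) 1 puts z in the
    span of 1 and x (lemma [LR_rank2]): being orthogonal to 1 and x is the only
    constraint on the values at x. *)

(** * Duality for linear maps *)

Section LinearAlgebra.
Variable F : fieldType.

Lemma lfun_of_linear (U V : vectType F) (f : U -> V) :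
  linear f -> exists h : 'Hom(U, V), h =1 f.
Proof.
move=> lf; pose fL : {linear U -> V} :=
  HB.pack f (GRing.isLinear.Build F U V _ f lf).
by exists (linfun fL) => u; rewrite lfunE.
Qed.

Lemma lfun_vbasisP (U V : vectType F) (f g : 'Hom(U, V)) :
  (forall i : 'I_(\dim {:U}), f (vbasis {:U})`_i = g (vbasis {:U})`_i) -> f =1 g.
Proof.
move=> fg u; rewrite (coord_vbasis (memvf u)) !linear_sum /=.
by apply: eq_bigr => i _; rewrite !linearZ /= fg.
Qed.

(** A vector belongs to the image under [g] of the kernel of [f] as soon as every
    functional whose composite with [g] factors through [f] kills it. *)
Lemma image_of_kernelP (T U V : vectType F) (f : 'Hom(T, U)) (g : 'Hom(T, V))
    (y : V) :
  (forall (phi : 'Hom(V, F^o)) (psi : 'Hom(U, F^o)),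
     (forall w, phi (g w) = psi (f w)) -> phi y = 0) ->
  exists2 w, f w = 0 & g w = y.
Proof.
move=> H; pose W := (g @: lker f)%VS.
have [/memv_imgP[w]|yW] := boolP (y \in W).
  by rewrite memv_ker => /eqP fw ->; exists w.
pose h : 'End(V) := (\1 - projv W)%VF.
(* [h] is a linear map with kernel exactly [W]. *)
have hE v : h v = v - projv W v by rewrite !lfunE /= !lfunE.
have hW v : v \in W -> h v = 0.
  by move=> vW; rewrite hE projv_id // subrr.
have hy : h y != 0.
  apply: contra yW; rewrite hE subr_eq0 => /eqP ->.
  by rewrite -{2}(limg_proj W) memv_img ?memvf.
suff coord0 i : coord (vbasis {:V}) i (h y) = 0.
  by rewrite (coord_vbasis (memvf (h y))) big1 ?eqxx // in hy => i _;
     rewrite coord0 scale0r.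
have [k kE] : exists k : 'Hom(V, F^o), k =1 coord (vbasis {:V}) i.
  by apply: lfun_of_linear => a u v; rewrite linearP.
(* A functional killing [g @: lker f] factors through [f], by way of any right
   inverse of [f] on its image. *)
have := H (k \o h)%VF (k \o h \o g \o f^-1)%VF.
rewrite !comp_lfunE /= kE; apply=> w; rewrite !comp_lfunE.
congr (k _); apply/eqP; rewrite -subr_eq0 -!linearB; apply/eqP.
apply: hW; apply: memv_img.
by rewrite memv_ker linearB /= limg_lfunVK ?subrr // memv_img ?memvf.
Qed.

End LinearAlgebra.

(** * Nonsingular quadratic forms *)

Section QuadraticForm.
Variables (F : fieldType) (V : vectType F) (n : V -> F).
Hypothesis nQ : quadratic_form n.
Local Notation b := (polar n).

Lemma polarC x y : b x y = b y x.
Proof. by rewrite /polar (addrC x) addrAC. Qed.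

Lemma polarDZl a x y z : b (a *: x + y) z = a * b x z + b y z.
Proof. exact: (polar_linearl nQ z a x y). Qed.

Lemma polarDl x y z : b (x + y) z = b x z + b y z.
Proof. by rewrite -{1}[x]scale1r polarDZl mul1r. Qed.

Lemma polar0l z : b 0 z = 0.
Proof. by apply: (addIr (b 0 z)); rewrite -polarDl !add0r. Qed.

Lemma polarZl a x z : b (a *: x) z = a * b x z.
Proof. by rewrite -{1}[a *: x]addr0 polarDZl polar0l addr0. Qed.

Lemma polarNl x z : b (- x) z = - b x z.
Proof. by rewrite -scaleN1r polarZl mulN1r. Qed.

Lemma polarDr x y z : b z (x + y) = b z x + b z y.
Proof. by rewrite !(polarC z) polarDl. Qed.

Lemma polarZr a x z : b z (a *: x) = a * b z x.
Proof. by rewrite !(polarC z) polarZl. Qed.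

Lemma polarNr x z : b z (- x) = - b z x.
Proof. by rewrite !(polarC z) polarNl. Qed.

Lemma polar0r z : b z 0 = 0.
Proof. by rewrite polarC polar0l. Qed.

Definition polarE := (polarDl, polarDr, polarZl, polarZr, polarNl, polarNr).

Lemma polar_suml I (r : seq I) (P : pred I) (f : I -> V) z :
  b (\sum_(i <- r | P i) f i) z = \sum_(i <- r | P i) b (f i) z.
Proof. by apply: (big_morph (b^~ z)) => [x y|]; rewrite ?polarDl ?polar0l. Qed.

Lemma qformD x y : n (x + y) = n x + n y + b x y.
Proof. by rewrite /polar; ring. Qed.

Lemma polarxx x : b x x = n x *+ 2.
Proof.
rewrite /polar -[x + x]/(x *+ 2) -scaler_nat (quadratic_formZ nQ); ring.
Qed.

Hypothesis nR : nonsingular n.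

Lemma polar_inj x y : (forall w, b x w = b y w) -> x = y.
Proof.
move=> xy; apply/eqP; rewrite -subr_eq0; apply/eqP/nR => w.
by rewrite !polarE xy subrr.
Qed.

(** A nonsingular form represents every linear functional. *)
Lemma polar_riesz (f : 'Hom(V, F^o)) : exists p, forall v, f v = b p v.
Proof.
pose e i := (vbasis {:V})`_i.
have bE v : exists h : 'Hom(V, F^o), h =1 b v.
  by apply: lfun_of_linear => a x y; rewrite !polarE.
(* [G] packs the values of [b v] on the basis [e] into a vector; it is injective
   by nonsingularity, hence bijective. *)
have [G GE] : exists G : 'End(V),
    G =1 fun v => \sum_(i < \dim {:V}) b v (e i) *: e i.
  apply: lfun_of_linear => a x y; rewrite scaler_sumr -big_split /=.
  by apply: eq_bigr => i _; rewrite !polarE scalerDl scalerA.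
have sum_inj (k l : 'I_(\dim {:V}) -> F) :
    \sum_i k i *: e i = \sum_i l i *: e i -> k =1 l.
  have fr := basis_free (vbasisP {:V}).
  by move=> kl i; rewrite -(coord_sum_free k i fr) kl coord_sum_free.
have /lker0_lfunVK GK : lker G == 0%VS.
  apply/lker0P => x y; rewrite !GE => /sum_inj xy; apply: polar_inj => w.
  have [hx hxE] := bE x; have [hy hyE] := bE y; rewrite -hxE -hyE.
  rewrite (coord_vbasis (memvf w)) !linear_sum /=.
  by apply: eq_bigr => i _; rewrite !linearZ /= hxE hyE xy.
exists ((G^-1)%VF (\sum_(i < \dim {:V}) (f (e i) : F) *: e i)).
set p := (G^-1)%VF _ => v; have [hp hpE] := bE p; rewrite -hpE.
have /sum_inj pE := etrans (esym (GE p)) (GK _).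
rewrite (coord_vbasis (memvf v)) !linear_sum /=.
by apply: eq_bigr => i _; rewrite !linearZ /= hpE pE.
Qed.

Lemma nonsingular_neq0 (x : V) : x != 0 -> exists y, b x y = 1.
Proof.
move=> x0.
have [[i]|] := altP (@existsP _ (fun i => coord (vbasis {:V}) i x != 0)).
  move=> ci; have [k kE] : exists k : 'Hom(V, F^o), k =1 coord (vbasis {:V}) i.
    by apply: lfun_of_linear => a u v; rewrite linearP.
  have [p pE] := polar_riesz k; exists ((b p x)^-1 *: p).
  by rewrite polarZr (polarC x) mulVf // -pE kE.
rewrite negb_exists => /forallP c0; case/eqP: x0.
rewrite (coord_vbasis (memvf x)) big1 // => i _.
by move: (c0 i); rewrite negbK => /eqP ->; rewrite scale0r.
Qed.

Lemma so_skew (d : 'End(V)) : so n d -> forall x y, b x (d y) = - b (d x) y.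
Proof.
move=> hd x y; have := hd (x + y).
rewrite linearD /= !polarE !hd add0r addr0 (polarC y) => /eqP.
by rewrite addr_eq0 => /eqP.
Qed.

End QuadraticForm.

(** * Identities in a Cayley algebra *)

Section Cayley.
Variables (F : fieldType) (C : vectType F).
Variables (mul : {bilinear C -> C -> C}) (one : C) (n : C -> F).
Hypothesis hC : cayley_algebra mul one n.

Local Notation b := (polar n).
Local Notation "x ** y" := (mul x y) (at level 40, left associativity).
Let nQ := cayley_norm_quadratic hC.
Let nR := cayley_norm_nonsingular hC.
Let nM := cayley_normM hC.
Let mul1x := cayley_mul1l hC.
Let mulx1 := cayley_mul1r hC.
Let bE := polarE nQ.

(** The standard conjugation.  It is locked so that the bilinearity rules, used as
    rewrite rules, do not see through it to the difference. *)
Definition cayley_conj x := locked (b one x *: one - x).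
Local Notation "x ^bar" := (cayley_conj x) (at level 2, format "x ^bar").

Lemma conjE x : x^bar = b one x *: one - x.
Proof. by rewrite /cayley_conj -lock. Qed.

Lemma mulDl x y z : (x + y) ** z = x ** z + y ** z.
Proof. exact: linearDl. Qed.
Lemma mulDr x y z : z ** (x + y) = z ** x + z ** y.
Proof. exact: linearDr. Qed.
Lemma mulZl a x z : (a *: x) ** z = a *: (x ** z).
Proof. exact: linearZl_LR. Qed.
Lemma mulZr a x z : z ** (a *: x) = a *: (z ** x).
Proof. exact: linearZr. Qed.
Lemma mulNl x z : (- x) ** z = - (x ** z).
Proof. exact: linearNl. Qed.
Lemma mulNr x z : z ** (- x) = - (z ** x).
Proof. exact: linearNr. Qed.

Let mE := (mulDl, mulDr, mulZl, mulZr, mulNl, mulNr, mul1x, mulx1).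

Lemma polar_mull x y z : b (x ** y) (x ** z) = n x * b y z.
Proof. by rewrite /polar -mulDr !nM; ring. Qed.

(** The full linearization of the multiplicativity of the norm, from which all
    the identities below follow. *)
Lemma polar_mul4 x y z w :
  b (x ** y) (z ** w) + b (x ** w) (z ** y) = b x z * b y w.
Proof.
have := polar_mull (x + z) y w.
rewrite !mulDl !bE !polar_mull qformD (polarC n (z ** y)) => E.
have -> : b x z * b y w =
    (n x + n z + b x z) * b y w - n x * b y w - n z * b y w by ring.
by rewrite -E; ring.
Qed.

Lemma norm_one : n one = 1.
Proof.
have n11 : n one * n one = n one by rewrite -nM mul1x.
have [n10|n1N] := eqVneq (n one) 0; last by apply: (mulfI n1N); rewrite n11 mulr1.
have nz x : n x = 0 by rewrite -[x]mul1x nM n10 mul0r.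
have fullv0 : {:C}%VS = 0%VS.
  apply/eqP; rewrite -subv0; apply/subvP => x _; rewrite memv0; apply/eqP/nR => y.
  by rewrite /polar !nz !subr0.
by have := cayley_dim hC; rewrite fullv0 dimv0.
Qed.

Lemma polar11 : b one one = 2.
Proof. by rewrite polarxx // norm_one. Qed.

Lemma conjK x : x^bar^bar = x.
Proof. by apply: (polar_inj nQ nR) => w; rewrite !conjE !bE polar11; ring. Qed.

Lemma polar_conj x y : b x^bar y^bar = b x y.
Proof. by rewrite !conjE !bE polar11 (polarC n x one); ring. Qed.

Lemma polar_conjC x y : b x^bar y = b x y^bar.
Proof. by rewrite -polar_conj conjK. Qed.

Lemma adjl x y w : b (x ** y) w = b y (x^bar ** w).
Proof.
have := polar_mul4 x y one w; rewrite !mul1x !conjE !mE !bE => E.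
by rewrite (polarC n one) -E (polarC n y); ring.
Qed.

Lemma adjr x y w : b (y ** x) w = b y (w ** x^bar).
Proof.
have := polar_mul4 y x w one; rewrite !mulx1 !conjE !mE !bE => E.
by rewrite (polarC n one) (mulrC (b x one)) -E; ring.
Qed.

Lemma conjM x y : (x ** y)^bar = y^bar ** x^bar.
Proof.
apply: (polar_inj nQ nR) => w.
by rewrite polar_conjC adjl [RHS]adjl conjK [RHS]polarC adjr.
Qed.

Lemma conj_mull_lin x y z : x^bar ** (z ** y) + z^bar ** (x ** y) = b x z *: y.
Proof.
apply: (polar_inj nQ nR) => w.
by rewrite !bE !(adjl _^bar) !conjK (polarC n (z ** y)) addrC polar_mul4.
Qed.

Lemma conj_mulK x y : x^bar ** (x ** y) = n x *: y.
Proof.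
by apply: (polar_inj nQ nR) => w; rewrite adjl conjK polar_mull bE.
Qed.

Lemma conj_mul x : x^bar ** x = n x *: one.
Proof. by rewrite -{2}[x]mulx1 conj_mulK. Qed.

Lemma mul_anticomm x y :
  x ** y + y ** x = b one x *: y + b one y *: x - b x y *: one.
Proof.
have := conj_mull_lin x one y; rewrite !mulx1 => <-.
apply: (polar_inj nQ nR) => w.
by rewrite !conjE !mE !bE; ring.
Qed.

Lemma mul_sqr x : x ** x = b one x *: x - n x *: one.
Proof.
rewrite -conj_mul; apply: (polar_inj nQ nR) => w.
by rewrite !conjE !mE !bE; ring.
Qed.

(** * Construction of derivations *)

(** Local triality.  The map T z = b(z,c) a - b(z,a) c + b(a,c) z satisfies a
    Leibniz rule T(xy) = (T1 x) y + x (T2 y) with companions T1 = L_a L_c' and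
    T2 = R_a R_c'. *)
Lemma triality a c x y :
  b (x ** y) c *: a - b (x ** y) a *: c + b a c *: (x ** y) =
  (a ** (c^bar ** x)) ** y + x ** ((y ** c^bar) ** a).
Proof.
apply: (polar_inj nQ nR) => w; rewrite !bE.
have -> : b (a ** (c^bar ** x) ** y) w =
    b a w * b (x ** y) c - b (a ** y^bar) (w ** (c^bar ** x)).
  rewrite adjr; have := polar_mul4 a (c^bar ** x) w y^bar.
  by rewrite (adjl c^bar) conjK (adjr _ x) => <-; ring.
have -> : b (x ** (y ** c^bar ** a)) w =
    b a c * b (x ** y) w - b (a ** y^bar) (c ** (w^bar ** x)).
  rewrite adjl adjr -polar_conj !conjM !conjK.
  have := polar_mul4 c y^bar a (w^bar ** x).
  have -> : b y^bar (w^bar ** x) = b (x ** y) w.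
    by rewrite -polar_conj conjM !conjK adjl.
  by rewrite (polarC n c a) (polarC n (a ** _)) => <-; ring.
have := congr1 (b (a ** y^bar)) (conj_mull_lin w^bar x c^bar).
rewrite !conjK polar_conj !bE (polarC n (a ** _) x) -adjr => E.
have -> : b (a ** y^bar) (w ** (c^bar ** x)) =
   b w c * b (x ** y) a - b (a ** y^bar) (c ** (w^bar ** x)) by rewrite -E; ring.
by rewrite (polarC n c w); ring.
Qed.

Lemma derivation_of_sum (I : finType) (a c : I -> C) :
  \sum_i a i ** (c i)^bar = 0 -> \sum_i (c i)^bar ** a i = 0 ->
  exists2 d : 'End(C), derivation mul d &
    forall x, d x = \sum_i (b x (c i) *: a i - b x (a i) *: c i).
Proof.
move=> s1 s2.
pose D z := \sum_i (b z (c i) *: a i - b z (a i) *: c i).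
have [d dE] : exists d : 'End(C), d =1 D.
  apply: lfun_of_linear => k u v.
  rewrite scaler_sumr -big_split /=; apply: eq_bigr => i _.
  by apply: (polar_inj nQ nR) => w; rewrite !bE; ring.
exists d => // x y; rewrite !dE.
have tr0 : \sum_i b (a i) (c i) = 0.
  have := polar0l nQ one; rewrite -s1 polar_suml //; apply: etrans.
  by apply: eq_bigr => i _; rewrite adjr conjK mul1x.
have DM u v : D (u ** v) = \sum_i ((a i ** ((c i)^bar ** u)) ** v +
                                    u ** ((v ** (c i)^bar) ** a i)).
  rewrite -[LHS]addr0 -[X in _ + X](scale0r (u ** v)).
  rewrite -[X in X *: (u ** v)]tr0 scaler_suml -big_split /=.
  by apply: eq_bigr => i _; rewrite -triality.
have mul_suml f v : \sum_i f i ** v = (\sum_i f i) ** v.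
  by rewrite linear_sumlz.
have mul_sumr f v : \sum_i v ** f i = v ** (\sum_i f i) by rewrite linear_sumr.
(* The hypotheses say that both companions of [D] kill [one]; taking one factor
   equal to [one] in [DM] then identifies each companion with [D]. *)
have D1 u : D u = \sum_i a i ** ((c i)^bar ** u).
  rewrite -[u in LHS]mulx1 DM big_split /=.
  under eq_bigr do rewrite mulx1.
  under [X in _ + X]eq_bigr do rewrite mul1x.
  by rewrite mul_sumr s2 linear0r addr0.
have D2 v : D v = \sum_i (v ** (c i)^bar) ** a i.
  rewrite -[v in LHS]mul1x DM big_split /=.
  under eq_bigr do rewrite mulx1.
  under [X in _ + X]eq_bigr do rewrite mul1x.
  by rewrite mul_suml s1 linear0l add0r.
by rewrite DM big_split /= mul_suml mul_sumr -D1 -D2.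
Qed.

(** * Derivations are skew *)

Lemma derivation1 (d : 'End(C)) : derivation mul d -> d one = 0.
Proof.
move=> hd; have := hd one one; rewrite !mul1x mulx1 => /eqP.
by rewrite -subr_eq0 opprD addNKr oppr_eq0 => /eqP.
Qed.

Lemma derivation_so (d : 'End(C)) : derivation mul d -> so n d.
Proof.
move=> hd x; have d1 := derivation1 hd.
have dZ k u : d (k *: u) = k *: d u by rewrite linearZ.
have [/vlineP[k ->]|x1] := boolP (x \in <[one]>%VS).
  by rewrite dZ d1 scaler0 polar0r.
have := hd x x; rewrite mul_anticomm mul_sqr linearB /= !dZ d1 scaler0 subr0.
rewrite (polarC n (d x)) => E.
(* Cancel [b one x *: d x] in the two expressions [E] of [d (x ** x)]. *)
have {E} : b one (d x) *: x = b x (d x) *: one.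
  apply/eqP; rewrite -subr_eq0; apply/eqP.
  by apply: (addIr (b one x *: d x)); rewrite add0r {2}E addrAC.
have [t0|t0 E] := eqVneq (b one (d x)) 0.
  rewrite t0 scale0r => /esym/eqP; rewrite scaler_eq0 => /orP[/eqP //|/eqP one0].
  by move: x1; rewrite -[x]mul1x one0 linear0l mem0v.
case/negP: x1; apply/vlineP; exists ((b one (d x))^-1 * b x (d x)).
by rewrite -scalerA -E scalerA mulVf // scale1r.
Qed.

(** * The image of a nonscalar element under all derivations *)

(** Left multiplication by a nonzero skew [r] has an image of dimension at least
    4, and of dimension 8 when [n r] is nonzero; the image contains [one] only in
    the second case. *)
Lemma mul_image_small r (S : {vspace C}) :
  r^bar = - r -> (forall c, r ** c \in S) -> (\dim S <= 4)%N -> one \in S -> r = 0.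
Proof.
move=> rN rS S4 S1; apply/eqP/negPn/negP => r0.
have [L LE] : exists L : 'End(C), L =1 mul r.
  by apply: lfun_of_linear => a u v; rewrite linearPr.
have LS : (limg L <= S)%VS by apply/subvP => _ /memv_imgP[c _ ->]; rewrite LE.
have nr0 : n r = 0.
  apply/eqP/negPn/negP => nr.
  have L0 : lker L == 0%VS.
    apply/lker0P => u v; rewrite !LE => E.
    by apply: (scalerI nr); rewrite -!conj_mulK E.
  have := dimvS LS; rewrite limg_dim_eq ?(cayley_dim hC) ?(eqP L0) ?capv0 //.
  by move=> h; have := leq_trans h S4.
have [s rs] := nonsingular_neq0 nQ nR r0.
(* If [r ** c = 0] then c = (b r s) c = r' (s c), which lies in the image. *)
have kerL : (lker L <= limg L)%VS.
  apply/subvP => c; rewrite memv_ker LE => /eqP rc.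
  have := conj_mull_lin r c s; rewrite rs rc scale1r linear0r addr0 rN => <-.
  by rewrite mulNl -mulNr -LE memv_img ?memvf.
have := limg_ker_dim L fullv; rewrite capfv (cayley_dim hC) => dimL.
have imS : limg L = S.
  apply/eqP; rewrite eqEdim LS /=.
  by have := dimvS kerL; lia.
move: S1; rewrite -imS => /memv_imgP[v _]; rewrite LE => rv.
by have := oner_eq0 F; rewrite -norm_one rv nM nr0 mul0r eqxx.
Qed.

Lemma dual_of_nonscalar x : x \notin <[one]>%VS ->
  exists2 c, b one c = 0 & b x c = 1.
Proof.
move=> x1.
have one0 : one != 0.
  by apply: contraNneq x1 => one0; rewrite -[x]mul1x one0 linear0l mem0v.
have [c0 c01] := nonsingular_neq0 nQ nR one0.
have [y] : exists y, b (x - b x c0 *: one) y = 1.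
  apply: nonsingular_neq0 => //; apply: contraNneq x1 => /eqP.
  by rewrite subr_eq0 => /eqP ->; rewrite memvZ ?memv_line.
rewrite !bE => xy; exists (y - b one y *: c0); rewrite !bE ?c01; first by ring.
by rewrite -xy; ring.
Qed.

(** The infinitesimal rotation in the plane of [x] and [z] is of the form L_p + R_q
    only if this plane contains [one] or degenerates. *)
Lemma LR_rank2 p q x z : x \notin <[one]>%VS ->
  (forall c, p ** c + c ** q = b x c *: z - b z c *: x) ->
  exists k l, z = k *: one + l *: x.
Proof.
move=> x1 pq; pose r := p + q^bar.
have rE c : r ** c = b x c *: z - b z c *: x - b one c *: q + b q c *: one.
  rewrite -pq; have := mul_anticomm q c => E.
  have -> : b one c *: q = q ** c + c ** q - b one q *: c + b q c *: one.
    by rewrite E; apply: (polar_inj nQ nR) => w; rewrite !bE; ring.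
  by apply: (polar_inj nQ nR) => w; rewrite /r !conjE !mE !bE; ring.
have r0 : r = 0.
  apply: (@mul_image_small _ <<[:: one; x; z; q]>>%VS).
  - apply: (polar_inj nQ nR) => w; rewrite -[r^bar]mulx1.
    rewrite adjl conjK -[X in - X]mulx1 !rE !bE.
    by rewrite (polarC n x one) (polarC n z one) (polarC n q one); ring.
  - move=> c.
    by rewrite rE rpredD ?rpredB ?rpredZ ?memv_span ?inE ?eqxx ?orbT.
  - exact: dim_span.
  - by rewrite memv_span ?inE ?eqxx.
(* With [r = 0], evaluate [rE] at a vector orthogonal to [one] but not to [x]. *)
have [c oc xc] := dual_of_nonscalar x1.
exists (- b q c), (b z c); have := rE c.
rewrite r0 linear0l xc oc scale1r scale0r subr0 => E.
by rewrite -[LHS]subr0 E; apply: (polar_inj nQ nR) => w; rewrite !bE; ring.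
Qed.

(** Derivations move a nonscalar [x] to every vector that skewness and the
    vanishing at [one] allow. *)
Lemma derivation_transitive x y : x \notin <[one]>%VS ->
  b one y = 0 -> b x y = 0 -> exists2 d : 'End(C), derivation mul d & d x = y.
Proof.
move=> x1 y1 xy; pose k := \dim {:C}; pose e (i : 'I_k) := (vbasis {:C})`_i.
(* A tuple [w] stands for the tensor with components w_i (x) e_i: [f] collects the
   two conditions of [derivation_of_sum], and [g] is the value at [x]. *)
have [f fE] : exists f : 'Hom({ffun 'I_k -> C}, (C * C)%type),
    f =1 fun w => (\sum_i w i ** (e i)^bar, \sum_i (e i)^bar ** w i).
  apply: lfun_of_linear => a u v.
  congr pair; rewrite /= scaler_sumr -big_split /=;
    by apply: eq_bigr => i _; rewrite !ffunE !mE.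
have [g gE] : exists g : 'Hom({ffun 'I_k -> C}, C),
    g =1 fun w => \sum_i (b x (e i) *: w i - b x (w i) *: e i).
  apply: lfun_of_linear => a u v; rewrite scaler_sumr -big_split /=.
  apply: eq_bigr => i _; rewrite !ffunE; apply: (polar_inj nQ nR) => w.
  by rewrite !bE; ring.
have [|w fw gw] := @image_of_kernelP _ _ _ _ f g y; last first.
  move: fw; rewrite fE => -[s1 s2].
  have [d dd dE] := derivation_of_sum s1 s2.
  by exists d; rewrite // dE -gw gE.
move=> phi psi E.
have [z zE] := polar_riesz nQ nR phi.
have [p1 p1E] : exists h : 'Hom(C, F^o), h =1 fun u => psi (u, 0).
  by apply: lfun_of_linear => a u v; rewrite -linearP /=;
     congr (psi (pair _ _)); rewrite /= scaler0 addr0.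
have [p2 p2E] : exists h : 'Hom(C, F^o), h =1 fun u => psi (0, u).
  by apply: lfun_of_linear => a u v; rewrite -linearP /=;
     congr (psi (pair _ _)); rewrite /= scaler0 addr0.
have [p pE] := polar_riesz nQ nR p1; have [q qE] := polar_riesz nQ nR p2.
have psiE u v : psi (u, v) = b p u + b q v.
  rewrite -pE -qE p1E p2E -(linearD psi) /=.
  by congr (psi (pair _ _)); rewrite /= ?addr0 ?add0r.
(* Test the functional identity on the elementary tensor a (x) e_i. *)
have key i a : b (p ** e i + e i ** q) a = b (b x (e i) *: z - b z (e i) *: x) a.
  pose w : {ffun 'I_k -> C} := [ffun j => if j == i then a else 0].
  have := E w; rewrite gE fE psiE zE.
  rewrite (bigD1 i) //= big1 => [|j /negPf ji]; last first.
    by rewrite !ffunE ji scaler0 polar0r // scale0r subr0.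
  rewrite (bigD1 i) //= big1 => [|j /negPf ji]; last by rewrite !ffunE ji linear0l.
  rewrite (bigD1 i) //= big1 => [|j /negPf ji]; last by rewrite !ffunE ji linear0r.
  rewrite !ffunE eqxx !addr0 => E'.
  by rewrite !bE (adjr (e i) p) (adjl (e i) q) -E' !bE; ring.
have pq c : p ** c + c ** q = b x c *: z - b z c *: x.
  have [l lE] : exists l : 'End(C), l =1 fun c => p ** c + c ** q.
    apply: lfun_of_linear => a u v; apply: (polar_inj nQ nR) => w.
    by rewrite !mE !bE; ring.
  have [m mE'] : exists m : 'End(C), m =1 fun c => b x c *: z - b z c *: x.
    apply: lfun_of_linear => a u v; apply: (polar_inj nQ nR) => w.
    by rewrite !bE; ring.
  rewrite -lE -mE'; apply: lfun_vbasisP => i; rewrite lE mE'.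
  by apply: (polar_inj nQ nR) => w; apply: key.
have [k1 [k2 zE']] := LR_rank2 x1 pq.
by rewrite zE zE' !bE y1 xy !mulr0 addr0.
Qed.

(** * Local derivations *)

Lemma local_derivationP (D : 'End(C)) :
  local_derivation mul D <-> so n D /\ D one = 0.
Proof.
split=> [hD|[hD D1] x].
  split=> [x|]; last by have [d [dd ->]] := hD one; apply: derivation1.
  by have [d [dd ->]] := hD x; apply: derivation_so.
have [/vlineP[k ->]|x1] := boolP (x \in <[one]>%VS).
  exists 0; split=> [u v|]; first by rewrite !lfunE /= linear0l linear0r addr0.
  by rewrite lfunE /= linearZ /= D1 scaler0.
have y1 : b one (D x) = 0 by rewrite (so_skew nQ hD) D1 polar0l // oppr0.
have [d dd dx] := derivation_transitive x1 y1 (hD x).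
by exists d.
Qed.

End Cayley.

Lemma so_stabilizer_lie (F : fieldType) (V : vectType F) (n : V -> F) (v : V) :
  quadratic_form n -> lie_subalgebra (fun d : 'End(V) => so n d /\ d v = 0).
Proof.
move=> nQ; split.
- by split=> [x|]; rewrite lfunE ?polar0r.
- move=> a f g [hf fv] [hg gv]; split=> [x|]; rewrite !lfunE /= !lfunE /=.
    by rewrite (polarDr nQ) (polarZr nQ) hf hg mulr0 addr0.
  by rewrite fv gv scaler0 addr0.
- move=> f g [hf fv] [hg gv]; split=> [x|]; rewrite !lfunE /= !lfunE /= !lfunE /=.
    rewrite (polarDr nQ) (polarNr nQ) (so_skew nQ hf x) (so_skew nQ hg x).
    by rewrite (polarC n (g x)) subrr.
  by rewrite fv gv !linear0 addr0.
Qed.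

Theorem theorem3p1 (F : fieldType) (C : vectType F)
    (mul : {bilinear C -> C -> C}) (one : C) (n : C -> F)
    (hC : cayley_algebra mul one n) :
  (forall D : 'End(C), local_derivation mul D <-> so n D /\ D one = 0) /\
  lie_subalgebra (fun d : 'End(C) => so n d /\ d one = 0).
Proof.
split; first exact: local_derivationP.
exact/so_stabilizer_lie/(cayley_norm_quadratic hC).
Qed.
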